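(* Let $C_D=V(p^2+18p-8q-27)\subset\mathbb{C}^2$ and let $G_D:\mathbb{C}\to\mathbb{C}^2$, $G_D(u)=(5+2u,\ 11+7u+u^2/2)$. For $d\in\mathbb{N}$ let $g_d$ be the Chebyshev-induced morphism on $\mathbb{C}^2/D_3\simeq\mathbb{C}^2$. Then: (1) $g_d(G_D(u))=G_D(T_d(u))$ for all $u\in\mathbb{C}$ and $d\in\mathbb{N}$; (2) $g_d(C_D)=C_D$ for all $d\in\mathbb{N}$.
   Context: $\mathbb{N}=\{1,2,\dots\}$. $T_d(z)$ is the one-variable Chebyshev polynomial with $T_d(s+s^{-1})=s^d+s^{-d}$. Definition of $g_d$: the Chebyshev endomorphism $P_{A_2}^d:\mathbb{C}^2\to\mathbb{C}^2$ is defined by $P_{A_2}^d(e_1(t),e_2(t))=(e_1(t^d),e_2(t^d))$ for $t=(t_1,t_2,t_3)\in(\mathbb{C}^* )^3$ with $t_1t_2t_3=1$, where $t^d=(t_1^d,t_2^d,t_3^d)$ and $e_j$ is the $j$-th elementary symmetric polynomial. With $M_2(x,y)=(x+iy,\,x-iy)$ put $f_d=M_2^{-1}\circ P_{A_2}^d\circ M_2$. The surjective map $\tilde F:\mathbb{C}^2\to\mathbb{C}^2$, $\tilde F(x,y)=(x^2+y^2,\,x^3-3xy^2)$, is the quotient map by the dihedral group $D_3\subset GL(2,\mathbb{R})$ of order 6 generated by the rotation by $2\pi/3$ and $(x,y)\mapsto(x,-y)$; $g_d:\mathbb{C}^2\to\mathbb{C}^2$ (coordinates $(p,q)$) is the unique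 polynomial map with $g_d\circ\tilde F=\tilde F\circ f_d$. *)

(* Defs.v *)
From HB Require Import structures.
From mathcomp Require Import all_boot all_order all_algebra.
From mathcomp Require Import boolp classical_sets reals.
From mathcomp Require Import complex mpoly ring.

Set Implicit Arguments.
Unset Strict Implicit.
Unset Printing Implicit Defensive.

Import Order.TTheory GRing.Theory Num.Theory.

Local Open Scope ring_scope.

(* To be used with C := R[i], R : realType; the defining properties below    *)
(* determine T_d, P_{A_2}^d and g_d uniquely over any numClosedFieldType.    *)
Section Definitions.
Variable C : numClosedFieldType.

Definition pair_val (z : C * C) : 'I_2 -> C := tnth [tuple z.1; z.2].

Definition polyfun (h : C * C -> C) : Prop :=
  exists p : {mpoly C[2]}, forall z, h z = p.@[pair_val z].

Definition polymap (g : C * C -> C * C) : Prop :=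
  polyfun (fun z => (g z).1) /\ polyfun (fun z => (g z).2).

Definition chebT_spec (d : nat) (T : {poly C}) : Prop :=
  forall s : C, s != 0 -> T.[s + s^-1] = s ^+ d + s ^- d.

Definition e1 (t1 t2 t3 : C) : C := t1 + t2 + t3.
Definition e2 (t1 t2 t3 : C) : C := t1 * t2 + t1 * t3 + t2 * t3.

(* t1 t2 t3 = 1 forces all t_i to be nonzero. *)
Definition chebA2_spec (d : nat) (P : C * C -> C * C) : Prop :=
  forall t1 t2 t3 : C, t1 * t2 * t3 = 1 ->
    P (e1 t1 t2 t3, e2 t1 t2 t3) =
    (e1 (t1 ^+ d) (t2 ^+ d) (t3 ^+ d), e2 (t1 ^+ d) (t2 ^+ d) (t3 ^+ d)).

Definition M2 (z : C * C) : C * C := (z.1 + 'i * z.2, z.1 - 'i * z.2).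
Definition M2inv (w : C * C) : C * C :=
  ((w.1 + w.2) / 2, (w.1 - w.2) / (2 * 'i)).

Lemma M2K : cancel M2 M2inv.
Proof.
have i0 : 'i != 0 :> C by apply: neq0Ci.
by case=> x y; rewrite /M2 /M2inv /=; congr pair; field.
Qed.

Lemma M2invK : cancel M2inv M2.
Proof.
have i0 : 'i != 0 :> C by apply: neq0Ci.
by case=> a b; rewrite /M2 /M2inv /=; congr pair; field.
Qed.

(* The quotient map C^2 -> C^2 / D_3 = C^2. *)
Definition Ftilde (z : C * C) : C * C :=
  (z.1 ^+ 2 + z.2 ^+ 2, z.1 ^+ 3 - 3 * z.1 * z.2 ^+ 2).

Fixpoint chebT_rec (d : nat) : {poly C} * {poly C} :=
  if d is d'.+1 then
    let: (p, q) := chebT_rec d' in (q, 'X * q - p)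
  else (2%:P, 'X).

Lemma chebT_ex d : exists T, chebT_spec d T.
Proof.
exists (chebT_rec d).1 => s s0.
suff [] : (chebT_rec d).1.[s + s^-1] = s ^+ d + s ^- d /\
          (chebT_rec d).2.[s + s^-1] = s ^+ d.+1 + s ^- d.+1 by [].
elim: d => [|d]; first by rewrite /= !hornerE expr0 expr1 invr1; split; ring.
rewrite /=; case: (chebT_rec d) => p q /= [hp hq]; split=> //.
have sd0 : s ^+ d != 0 by rewrite expf_neq0.
rewrite !hornerE hp hq !exprS; field.
by rewrite s0 sd0.
Qed.

Lemma quad_root (b c : C) : exists x, x ^+ 2 - b * x + c = 0.
Proof.
exists ((b + sqrtC (b ^+ 2 - 4 * c)) / 2).
have := sqrtCK (b ^+ 2 - 4 * c); set r := sqrtC _ => hr.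
rewrite (_ : _ + c = (r ^+ 2 - (b ^+ 2 - 4 * c)) / 4); last by field.
by rewrite hr subrr mul0r.
Qed.

Lemma chebT_unique d T T' : chebT_spec d T -> chebT_spec d T' -> T = T'.
Proof.
move=> hT hT'; apply/eqP; rewrite -subr_eq0; apply/eqP.
have h u : root (T - T') u.
  have [s hs] := quad_root u 1.
  have s0 : s != 0.
    apply/eqP => s0; move: hs; rewrite s0 expr0n mulr0 subr0 add0r => /eqP.
    by rewrite oner_eq0.
  have -> : u = s + s^-1.
    apply: (mulfI s0); rewrite mulrDr divff // -expr2.
    by apply/eqP; rewrite -subr_eq0 -oppr_eq0 -[X in _ == X]hs; apply/eqP; ring.
  by rewrite rootE !hornerE hT // hT' // subrr.
apply: (@roots_geq_poly_eq0 _ _ [seq i%:R | i <- iota 0 (size (T - T'))]).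
- by apply/allP => x _; apply: h.
- by rewrite map_inj_uniq ?iota_uniq // => i j /eqP; rewrite eqr_nat => /eqP.
- by rewrite size_map size_iota.
Qed.

(* Newton's recurrence for t1^d + t2^d + t3^d in terms of a = e1, b = e2,    *)
(* when t1 t2 t3 = 1.                                                        *)
Fixpoint newton (a b : C) (d : nat) : C * C * C :=
  if d is d'.+1 then
    let: (x, y, z) := newton a b d' in (y, z, a * z - b * y + x)
  else (3, a, a ^+ 2 - 2 * b).

Definition newt (d : nat) (a b : C) : C := (newton a b d).1.1.

Lemma newt0 a b : newt 0 a b = 3. Proof. by []. Qed.
Lemma newt1 a b : newt 1 a b = a. Proof. by []. Qed.
Lemma newt2 a b : newt 2 a b = a ^+ 2 - 2 * b. Proof. by []. Qed.
Lemma newtS d a b :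
  newt d.+3 a b = a * newt d.+2 a b - b * newt d.+1 a b + newt d a b.
Proof. by rewrite /newt /=; case: (newton a b d) => [[x y] z]. Qed.

Lemma newtE d t1 t2 t3 : t1 * t2 * t3 = 1 ->
  newt d (e1 t1 t2 t3) (e2 t1 t2 t3) = t1 ^+ d + t2 ^+ d + t3 ^+ d.
Proof.
move=> ht; suff [] : [/\
  newt d (e1 t1 t2 t3) (e2 t1 t2 t3) = t1 ^+ d + t2 ^+ d + t3 ^+ d,
  newt d.+1 (e1 t1 t2 t3) (e2 t1 t2 t3) =
    t1 ^+ d.+1 + t2 ^+ d.+1 + t3 ^+ d.+1 &
  newt d.+2 (e1 t1 t2 t3) (e2 t1 t2 t3) =
    t1 ^+ d.+2 + t2 ^+ d.+2 + t3 ^+ d.+2] by [].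
elim: d => [|d [h0 h1 h2]].
  by rewrite newt0 newt1 newt2 /e1 /e2; split; ring.
split=> //; rewrite newtS h0 h1 h2 /e1 /e2 !exprS.
rewrite -[X in _ + X]mul1r -{1}ht; ring.
Qed.

Lemma newt_chebA2 d :
  chebA2_spec d (fun z => (newt d z.1 z.2, newt d z.2 z.1)).
Proof.
move=> t1 t2 t3 ht /=.
rewrite newtE //; congr pair.
have h : (t1 * t2) * (t1 * t3) * (t2 * t3) = 1.
  by rewrite -(expr1n _ 2) -ht; ring.
rewrite (_ : e2 t1 t2 t3 = e1 (t1 * t2) (t1 * t3) (t2 * t3)) //.
rewrite (_ : e1 t1 t2 t3 = e2 (t1 * t2) (t1 * t3) (t2 * t3)).
  by rewrite newtE // !exprMn.
by rewrite -[LHS]mul1r -ht /e1 /e2; ring.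
Qed.

Lemma chebA2_ex d : exists P, chebA2_spec d P.
Proof. by eexists; exact: newt_chebA2. Qed.

Lemma e12_surj a b : exists t1 t2 t3,
  t1 * t2 * t3 = 1 /\ (a, b) = (e1 t1 t2 t3, e2 t1 t2 t3).
Proof.
have [t1 ht1] := @solve_monicpoly C 3 (fun i => [:: 1; - b; a]`_i) isT.
rewrite !big_ord_recl big_ord0 /= /bump /= in ht1.
have {}ht1 : t1 * (t1 ^+ 2 - a * t1 + b) = 1.
  rewrite (_ : t1 * _ = t1 ^+ 3 - a * t1 ^+ 2 + b * t1); last by ring.
  by rewrite ht1; ring.
have t0 : t1 != 0.
  apply/eqP => t0; move: ht1; rewrite t0 mul0r => /esym/eqP.
  by rewrite oner_eq0.
have [t2 ht2] := quad_root (a - t1) (t1 ^+ 2 - a * t1 + b).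
exists t1, t2, (a - t1 - t2); split.
  rewrite -mulrA (_ : t2 * _ = t1 ^+ 2 - a * t1 + b) //.
  by apply/eqP; rewrite -subr_eq0 -oppr_eq0 -[X in _ == X]ht2; apply/eqP; ring.
congr pair; first by rewrite /e1; ring.
by apply/eqP; rewrite -subr_eq0 -[X in _ == X]ht2 /e2; apply/eqP; ring.
Qed.

Lemma chebA2_unique d P P' : chebA2_spec d P -> chebA2_spec d P' -> P = P'.
Proof.
move=> hP hP'; apply/funext => -[a b].
have [t1 [t2 [t3 [ht ->]]]] := e12_surj a b.
by rewrite hP // hP'.
Qed.

(* In chebT, chebA2 and gA2 the choice made by cid is immaterial, by the     *)
(* lemmas chebT_unique, chebA2_unique and gA2_unique.                        *)
Definition chebT (d : nat) : {poly C} := sval (cid (chebT_ex d)).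

Lemma chebTP d : chebT_spec d (chebT d).
Proof. exact: (svalP (cid (chebT_ex d))). Qed.

Definition chebA2 (d : nat) : C * C -> C * C := sval (cid (chebA2_ex d)).

Lemma chebA2P d : chebA2_spec d (chebA2 d).
Proof. exact: (svalP (cid (chebA2_ex d))). Qed.

Definition fA2 (d : nat) : C * C -> C * C := M2inv \o chebA2 d \o M2.

Definition gA2_spec (d : nat) (g : C * C -> C * C) : Prop :=
  polymap g /\ g \o Ftilde = Ftilde \o fA2 d.

Lemma polyfun_cst c : polyfun (fun=> c).
Proof. by exists c%:MP_[2] => z; rewrite mevalC. Qed.

Lemma polyfun_fst : polyfun fst.
Proof. by exists 'X_0 => z; rewrite mevalXU. Qed.

Lemma polyfun_snd : polyfun snd.
Proof. by exists 'X_1 => z; rewrite mevalXU. Qed.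

Lemma polyfunD h k :
  polyfun h -> polyfun k -> polyfun (fun z => h z + k z).
Proof. by move=> [p hp] [q hq]; exists (p + q) => z; rewrite mevalD hp hq. Qed.

Lemma polyfunM h k :
  polyfun h -> polyfun k -> polyfun (fun z => h z * k z).
Proof. by move=> [p hp] [q hq]; exists (p * q) => z; rewrite mevalM hp hq. Qed.

Lemma polyfunN h : polyfun h -> polyfun (fun z => - h z).
Proof. by move=> [p hp]; exists (- p) => z; rewrite mevalN hp. Qed.

Lemma polyfunX h n : polyfun h -> polyfun (fun z => h z ^+ n).
Proof. by move=> [p hp]; exists (p ^+ n) => z; rewrite rmorphXn hp. Qed.

Ltac polyfun_tac := repeat first
  [ assumption | exact: polyfun_fst | exact: polyfun_snd | exact: polyfun_cst
  | apply: polyfunD | apply: polyfunN | apply: polyfunM | apply: polyfunX ].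

(* Invariants of D_3 in the coordinates (a, b) = M2 (x, y). *)
Definition inv_ab (a b : C) : C * C := (a * b, (a ^+ 3 + b ^+ 3) / 2).

Lemma Ftilde_inv_ab z : Ftilde z = inv_ab (M2 z).1 (M2 z).2.
Proof.
case: z => x y; rewrite /Ftilde /inv_ab /=.
have hi := sqrCi C.
congr pair.
  rewrite (_ : (_ + _) * _ = x ^+ 2 - 'i ^+ 2 * y ^+ 2); last by ring.
  by rewrite hi; ring.
rewrite (_ : _ / 2 = x ^+ 3 + 3 * x * ('i ^+ 2) * y ^+ 2); last by field.
by rewrite hi; ring.
Qed.

(* newt d has weight d mod 3 under (a, b) |-> (w a, w^2 b), w^3 = 1; the     *)
(* polynomials of weight 0, 1, 2 are free over C[ab, a^3 + b^3] with bases   *)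
(* (1, a^3), (a, b^2), (a^2, b) respectively.                                *)
Lemma newt_weight k :
  [/\ exists al be, [/\ polyfun al, polyfun be & forall a b,
        newt (3 * k) a b = al (inv_ab a b) + be (inv_ab a b) * a ^+ 3],
      exists al be, [/\ polyfun al, polyfun be & forall a b,
        newt (3 * k).+1 a b = al (inv_ab a b) * a + be (inv_ab a b) * b ^+ 2] &
      exists al be, [/\ polyfun al, polyfun be & forall a b,
        newt (3 * k).+2 a b = al (inv_ab a b) * a ^+ 2 + be (inv_ab a b) * b]].
Proof.
elim: k => [|k [[al0 [be0 [pa0 pb0 h0]]] [al1 [be1 [pa1 pb1 h1]]]
                [al2 [be2 [pa2 pb2 h2]]]]].
  rewrite muln0; split.
  - exists (fun=> 3), (fun=> 0); split; [exact: polyfun_cst|exact: polyfun_cst|].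
    by move=> a b; rewrite newt0; ring.
  - exists (fun=> 1), (fun=> 0); split; [exact: polyfun_cst|exact: polyfun_cst|].
    by move=> a b; rewrite newt1; ring.
  - exists (fun=> 1), (fun=> - 2); split; [exact: polyfun_cst|exact: polyfun_cst|].
    by move=> a b; rewrite newt2; ring.
rewrite mulnS !addSn add0n.
pose al3 z := be2 z * z.1 - al1 z * z.1 - be1 z * (2 * z.2) + al0 z.
pose be3 z := al2 z + be1 z + be0 z.
have pa3 : polyfun al3 by rewrite /al3; polyfun_tac.
have pb3 : polyfun be3 by rewrite /be3; polyfun_tac.
have h3 a b : newt (3 * k).+3 a b =
    al3 (inv_ab a b) + be3 (inv_ab a b) * a ^+ 3.
  by rewrite newtS h0 h1 h2 /al3 /be3 [in RHS]/= ; field.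
pose al4 z := al3 z + be3 z * (2 * z.2) - al2 z * z.1 + al1 z.
pose be4 z := - (be3 z * z.1) - be2 z + be1 z.
have pa4 : polyfun al4 by rewrite /al4; polyfun_tac.
have pb4 : polyfun be4 by rewrite /be4; polyfun_tac.
have h4 a b : newt (3 * k).+4 a b =
    al4 (inv_ab a b) * a + be4 (inv_ab a b) * b ^+ 2.
  by rewrite newtS h1 h2 h3 /al4 /be4 [in RHS]/=; field.
pose al5 z := al4 z - be3 z * z.1 + al2 z.
pose be5 z := be4 z * z.1 - al3 z + be2 z.
have pa5 : polyfun al5 by rewrite /al5; polyfun_tac.
have pb5 : polyfun be5 by rewrite /be5; polyfun_tac.
split; first by exists al3, be3.
  by exists al4, be4.
exists al5, be5; split=> // a b.
by rewrite newtS h2 h3 h4 /al5 /be5 [in RHS]/=; ring.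
Qed.

Lemma inv_abC a b : inv_ab b a = inv_ab a b.
Proof. by rewrite /inv_ab mulrC [b ^+ 3 + _]addrC. Qed.

Lemma newt_inv d : exists g, polymap g /\
  forall a b, g (inv_ab a b) = inv_ab (newt d a b) (newt d b a).
Proof.
have := ltn_pmod d (isT : 0 < 3)%N.
move: (divn_eq d 3) (newt_weight (d %/ 3)).
move: (d %/ 3)%N (d %% 3)%N => k r -> [w0 w1 w2]; rewrite mulnC.
case: r => [|[|[|]]] // _; rewrite ?addn0 ?addn1 ?addn2.
- case: w0 => al [be [pa pb h]].
  exists (fun z => (al z ^+ 2 + al z * be z * (2 * z.2) + be z ^+ 2 * z.1 ^+ 3,
    (2 * al z ^+ 3 + 3 * al z ^+ 2 * be z * (2 * z.2)
     + 3 * al z * be z ^+ 2 * ((2 * z.2) ^+ 2 - 2 * z.1 ^+ 3)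
     + be z ^+ 3 * ((2 * z.2) ^+ 3 - 3 * z.1 ^+ 3 * (2 * z.2))) / 2)).
  split; first by split=> /=; polyfun_tac.
  move=> a b; rewrite !h inv_abC /=.
  by move: (al _) (be _) => x y; rewrite /inv_ab; congr pair; field.
- case: w1 => al [be [pa pb h]].
  exists (fun z => (al z ^+ 2 * z.1 + al z * be z * (2 * z.2)
                    + be z ^+ 2 * z.1 ^+ 2,
    (al z ^+ 3 * (2 * z.2) + 6 * al z ^+ 2 * be z * z.1 ^+ 2
     + 3 * al z * be z ^+ 2 * z.1 * (2 * z.2)
     + be z ^+ 3 * ((2 * z.2) ^+ 2 - 2 * z.1 ^+ 3)) / 2)).
  split; first by split=> /=; polyfun_tac.
  move=> a b; rewrite !h inv_abC /=.
  by move: (al _) (be _) => x y; rewrite /inv_ab; congr pair; field.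
- case: w2 => al [be [pa pb h]].
  exists (fun z => (al z ^+ 2 * z.1 ^+ 2 + al z * be z * (2 * z.2)
                    + be z ^+ 2 * z.1,
    (be z ^+ 3 * (2 * z.2) + 6 * be z ^+ 2 * al z * z.1 ^+ 2
     + 3 * be z * al z ^+ 2 * z.1 * (2 * z.2)
     + al z ^+ 3 * ((2 * z.2) ^+ 2 - 2 * z.1 ^+ 3)) / 2)).
  split; first by split=> /=; polyfun_tac.
  move=> a b; rewrite !h inv_abC /=.
  by move: (al _) (be _) => x y; rewrite /inv_ab; congr pair; field.
Qed.

Lemma chebA2E d z : chebA2 d z = (newt d z.1 z.2, newt d z.2 z.1).
Proof. by rewrite (chebA2_unique (@chebA2P d) (@newt_chebA2 d)). Qed.

Lemma gA2_ex d : exists g, gA2_spec d g.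
Proof.
have [g [pg hg]] := newt_inv d; exists g; split=> //.
apply/funext => z; rewrite /comp !Ftilde_inv_ab hg /fA2 /comp M2invK.
by rewrite chebA2E.
Qed.

Lemma Ftilde_surj w : exists z, Ftilde z = w.
Proof.
case: w => p q.
suff [a [b hab]] : exists a b, inv_ab a b = (p, q).
  by exists (M2inv (a, b)); rewrite Ftilde_inv_ab M2invK.
pose r := sqrtC (q ^+ 2 - p ^+ 3).
have hr : r ^+ 2 = q ^+ 2 - p ^+ 3 by exact: sqrtCK.
suff H s : s ^+ 2 = q ^+ 2 - p ^+ 3 -> q + s != 0 ->
    exists a b, inv_ab a b = (p, q).
  have [h1|] := eqVneq (q + r) 0; last exact: H.
  have [h2|] := eqVneq (q - r) 0; last by apply: H; rewrite sqrrN.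
  have q0 : q = 0.
    rewrite (_ : q = ((q + r) + (q - r)) / 2); last by field.
    by rewrite h1 h2 addr0 mul0r.
  have p0 : p = 0.
    have : p ^+ 3 = 0.
      rewrite (_ : p ^+ 3 = q ^+ 2 - (q ^+ 2 - p ^+ 3)); last by ring.
      rewrite -hr (_ : q ^+ 2 - r ^+ 2 = (q + r) * (q - r)); last by ring.
      by rewrite h1 mul0r.
    by move/eqP; rewrite expf_eq0 => /eqP.
  by exists 0, 0; rewrite p0 q0 /inv_ab mulr0 expr0n addr0 mul0r.
move=> hs hqs; pose a := 3.-root (q + s).
have ha : a ^+ 3 = q + s by exact: rootCK.
have a0 : a != 0 by apply: contra hqs => /eqP h; rewrite -ha h expr0n.
exists a, (p / a); rewrite /inv_ab; congr pair; first by field.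
rewrite expr_div_n ha (_ : p ^+ 3 = (q + s) * (q - s)); first by field.
rewrite (_ : (q + s) * _ = q ^+ 2 - s ^+ 2); last by ring.
by rewrite hs; ring.
Qed.

Lemma gA2_unique d g g' : gA2_spec d g -> gA2_spec d g' -> g = g'.
Proof.
move=> [_ h] [_ h']; apply/funext => w; have [z <-] := Ftilde_surj w.
by rewrite -[LHS]/((g \o Ftilde) z) h -h'.
Qed.

Definition gA2 (d : nat) : C * C -> C * C := sval (cid (gA2_ex d)).

Lemma gA2P d : gA2_spec d (gA2 d).
Proof. exact: (svalP (cid (gA2_ex d))). Qed.

Definition CD : set (C * C) :=
  [set z | z.1 ^+ 2 + 18 * z.1 - 8 * z.2 - 27 = 0]%classic.

Definition GD (u : C) : C * C := (5 + 2 * u, 11 + 7 * u + u ^+ 2 / 2).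

End Definitions.

Arguments CD : clear implicits.
Arguments chebT : clear implicits.

(* Main.v *)
(* On the discriminant t1 = t2 = s, t3 = s^-2 the quotient coordinates (p, q)
   depend only on u = s^3 + s^-3 and give the parametrization GD u. Since
   t |-> t^d preserves the discriminant, gA2 d sends GD u to the point with
   parameter s^(3d) + s^-(3d) = T_d(u). The curve CD is the image of GD, and T_d
   is onto for d > 0, hence the second claim. *)
Require Import Defs.
From HB Require Import structures.
From mathcomp Require Import all_boot all_order all_algebra.
From mathcomp Require Import boolp classical_sets reals.
From mathcomp Require Import complex ring.

Section ChebyshevDiscriminant.
Import Order.TTheory GRing.Theory Num.Theory.
Local Open Scope ring_scope.

Variable C : numClosedFieldType.
Implicit Types (s u v a b : C) (d : nat).

(** A root [s] of X^2 - u X + 1 is nonzero and satisfies [s + s^-1 = u]. *)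
Lemma joukowski_surj u : exists2 s, s != 0 & u = s + s^-1.
Proof.
have [s hs] := quad_root u 1.
have s0 : s != 0.
  apply/eqP => s0; move: hs; rewrite s0 expr0n mulr0 subr0 add0r => /eqP.
  by rewrite oner_eq0.
exists s => //; apply: (mulfI s0); rewrite mulrDr divff // -expr2.
by apply/eqP; rewrite -subr_eq0 -oppr_eq0 -[X in _ == X]hs; apply/eqP; ring.
Qed.

Lemma rootC_neq0 n s : (0 < n)%N -> s != 0 -> n.-root s != 0.
Proof. by move=> n0; rewrite rootC_eq0. Qed.

Lemma chebT_surj d v : (0 < d)%N -> exists u, (chebT C d).[u] = v.
Proof.
move=> d0; have [s s0 ->] := joukowski_surj v.
(* With r a [d]-th root of [s], T_d(r + 1/r) = r^d + 1/r^d = s + 1/s. *)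
exists (d.-root s + (d.-root s)^-1).
by rewrite chebTP ?rootC_neq0 // rootCK.
Qed.

(** The defining relation of [gA2] at [M2inv (a, b)], where the changes of coordinates cancel. *)
Lemma gA2_inv_ab d a b :
  gA2 d (inv_ab a b) = inv_ab (chebA2 d (a, b)).1 (chebA2 d (a, b)).2.
Proof.
have [_ /(congr1 (fun h => h (M2inv (a, b))))] := gA2P C d.
by rewrite /fA2 /comp !Ftilde_inv_ab !M2invK.
Qed.

Lemma GD_discriminant s : s != 0 ->
  GD (s ^+ 3 + s ^- 3) = inv_ab (e1 s s (s ^- 2)) (e2 s s (s ^- 2)).
Proof. by move=> s0; rewrite /GD /inv_ab /e1 /e2; congr pair; field. Qed.

Lemma gA2_GD d u : gA2 d (GD u) = GD (chebT C d).[u].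
Proof.
have [r r0 ->] := joukowski_surj u.
have s0 : 3.-root r != 0 by rewrite rootC_neq0.
(* A cube root of [r] gives the form s^3 + s^-3 of [GD_discriminant]. *)
have <- : 3.-root r ^+ 3 = r by exact: rootCK.
move: (3.-root r) s0 => s s0.
have hs : s * s * s ^- 2 = 1 by field.
rewrite GD_discriminant // gA2_inv_ab (chebA2P d hs) /=.
(* As (s^3)^d = (s^d)^3, [GD_discriminant] applies again, at [s ^+ d]. *)
rewrite chebTP ?expf_neq0 // -!exprVn -!exprM ![(_ * d)%N]mulnC !exprM !exprVn.
by rewrite GD_discriminant ?expf_neq0.
Qed.

Lemma GD_CD u : CD C (GD u).
Proof. by rewrite /CD /GD /mkset /=; field. Qed.

Lemma CD_GD z : CD C z -> exists u, z = GD u.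
Proof.
case: z => p q; rewrite /CD /mkset /= => hz; exists ((p - 5) / 2); rewrite /GD; congr pair; first by field.
(* The second coordinates differ by -1/8 times the equation of [CD]. *)
apply/eqP; rewrite -subr_eq0 -(mulr0 (- 8^-1)) -[X in _ == _ * X]hz.
by apply/eqP; field.
Qed.

Lemma gA2_CD d : (0 < d)%N -> [set gA2 d z | z in CD C]%classic = CD C.
Proof.
move=> d0; apply/seteqP; split=> [_ [z /CD_GD [u ->] <-]|z /CD_GD [v ->]].
  by rewrite gA2_GD; apply: GD_CD.
have [u <-] := chebT_surj d v d0.
by exists (GD u); [apply: GD_CD|rewrite gA2_GD].
Qed.

End ChebyshevDiscriminant.

Theorem theorem3p11 (R : realType) :
  (forall (u : R[i]) (d : nat), (0 < d)%N ->
     gA2 d (GD u) = GD (chebT R[i] d).[u]%R) /\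
  (forall d : nat, (0 < d)%N ->
     [set gA2 d z | z in CD R[i]]%classic = CD R[i]).
Proof.
by split=> [u d _|d]; [apply: gA2_GD|apply: gA2_CD].
Qed.
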